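(* Let $(X,d)$ be an unbounded metric space. For every ultrafilter $p\in X^\#$ the following two statements are equivalent: (i) $\mathrm{cl}\,\overline{\overline{p}}$ is a minimal closed invariant subset of $X^\#$; (ii) for every $P\in p$, there exists $r\geqslant 0$ such that $\overline{\overline{p}}\subseteq (B(P,r))^\#$.
   Context: For $x\in X$, $r\geqslant 0$, $A\subseteq X$: $B(x,r)=\{y\in X: d(x,y)\leqslant r\}$ and $B(A,r)=\bigcup_{a\in A}B(a,r)$. A subset $V\subseteq X$ is bounded if $V\subseteq B(x,r)$ for some $x\in X$, $r\geqslant 0$. $X$ is endowed with the discrete topology and $\beta X$ is its Stone-Čech compactification, identified with the set of all ultrafilters on $X$; the sets $\{p\in\beta X: A\in p\}$, $A\subseteq X$, form a base of the topology. For $Y\subseteq X$, $Y^\#=\{p\in\beta X: Y\in p \text{ and each } P\in p \text{ is unbounded in } X\}$. In particular $X^\#$ is the set of all ultrafilters on $X$ all of whose members are unbounded, with the subspace topology; $\mathrm{cl}$ denotes closure in $X^\#$. For $p,q\in X^\#$ write $p\parallel q$ if there is $r\geqslant 0$ such that $B(Q,r)\in p$ for each $Q\in q$ (this is an equivalence relation, called parallel equivalence). Put $\overline{\overline{p}}=\{q\in X^\#: p\parallel q\}$. A subset $S\subseteq X^\#$ is invariant if $\overline{\overline{p}}\subseteq S$ for each $p\in S$. A minimal closed invariant subset of $X^\#$ is a subset that is minimal by inclusion among the nonempty closed invariant subsets of $X^\#$. *)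

(* Defs.v *)
From HB Require Import structures.
From mathcomp Require Import all_boot all_order all_algebra.
From mathcomp Require Import all_classical all_reals all_analysis.

Set Implicit Arguments.
Unset Strict Implicit.
Unset Printing Implicit Defensive.

Import Order.TTheory GRing.Theory Num.Theory.

Local Open Scope classical_set_scope.
Local Open Scope ring_scope.

Record stone_cech (T : Type) := StoneCech {
  ultra_sets :> set T -> Prop ;
  ultra_setsP : UltraFilter ultra_sets
}.

HB.instance Definition _ (T : Type) := gen_eqMixin (stone_cech T).
HB.instance Definition _ (T : Type) := gen_choiceMixin (stone_cech T).

Definition stone_base (T : Type) (A : set T) : set (stone_cech T) :=
  [set p : stone_cech T | p A].

Section stone_topology.
Variable T : Type.

Local Lemma stone_base_cover :
  \bigcup_(A in [set: set T]) stone_base A = setT.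
Proof.
rewrite predeqE => p; split=> // _; exists setT => //=.
have pU := ultra_setsP p; exact: filterT.
Qed.

Local Lemma stone_base_join (A B : set T) (p : stone_cech T) :
  setT A -> setT B -> stone_base A p -> stone_base B p ->
  exists C, [/\ setT C, stone_base C p &
                stone_base C `<=` stone_base A `&` stone_base B].
Proof.
move=> _ _ pA pB; exists (A `&` B); split=> //.
  by have pU := ultra_setsP p; exact: filterI.
move=> q qAB; have qU := ultra_setsP q.
by split; apply: filterS qAB => x [].
Qed.

HB.instance Definition _ := isBaseTopological.Build (stone_cech T)
  stone_base_cover stone_base_join.

End stone_topology.

Section asymptotic.
Context {R : realType} {X : metricType R}.

(* The library's [closed_ball] is the topological closure of the open ball,
   which may be strictly smaller than [mball]. *)
Definition mball (x : X) (r : R) : set X := [set y | mdist x y <= r].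

Definition mball_set (A : set X) (r : R) : set X := \bigcup_(a in A) mball a r.

Definition mbounded (V : set X) : Prop :=
  exists x r, 0 <= r /\ V `<=` mball x r.

Definition sharp (Y : set X) : set (stone_cech X) :=
  [set p : stone_cech X | p Y /\ forall P, p P -> ~ mbounded P].

End asymptotic.

(* $X^\#$ as a type, so that [closure] and [closed] on it refer to the subspace
   topology inherited from $\beta X$. *)
Definition corona {R : realType} (X : metricType R) : Type :=
  set_type (sharp [set: X]).

HB.instance Definition _ {R : realType} (X : metricType R) :=
  SubChoice.copy (corona X) (set_type (sharp [set: X])).
HB.instance Definition _ {R : realType} (X : metricType R) :=
  Topological.copy (corona X) (set_type (sharp [set: X])).

Section parallel.
Context {R : realType} {X : metricType R}.
Implicit Types p q : corona X.

Definition parallel p q : Prop :=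
  exists r : R, 0 <= r /\ forall Q, val q Q -> val p (mball_set Q r).

Definition parallel_class p : set (corona X) := [set q | parallel p q].

Definition invariant_set (S : set (corona X)) : Prop :=
  forall p, S p -> parallel_class p `<=` S.

Definition nonempty_closed_invariant (S : set (corona X)) : Prop :=
  [/\ S !=set0, closed S & invariant_set S].

Definition minimal_closed_invariant (S : set (corona X)) : Prop :=
  nonempty_closed_invariant S /\
  forall S', nonempty_closed_invariant S' -> S' `<=` S -> S' = S.

End parallel.

(* Main.v *)
(** The one geometric fact is that [Q] belongs to some [q] parallel to [p] as
    soon as [B(Q, r)] belongs to [p] for some [r].  Hence closures of invariant
    sets are invariant, and [p] lies in the closure of the class of [q] iff
    every [P] in [p] has a ball [B(P, r)] in [q].  Minimality of the closure [K]
    of the class of [p] thus gives such an [r] for each [q] in [K]; if no [r]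
    were uniform over the class, ultrafilters [q_n] in the class avoiding
    [B(P, n)] would accumulate at some [q] in [K] avoiding all of these balls.
    Conversely a uniform [r] passes from the class to [K], so that [p] lies in
    every nonempty closed invariant subset of [K]. *)
Require Import Defs.
From HB Require Import structures.
From mathcomp Require Import all_boot all_order all_algebra.
From mathcomp Require Import all_classical all_reals all_analysis.

Import Order.TTheory GRing.Theory Num.Theory.

Local Open Scope classical_set_scope.
Local Open Scope ring_scope.

Lemma filterI_ex {T : Type} {F : set_system T} {FF : ProperFilter F}
  {A B : set T} : F A -> F B -> (A `&` B) !=set0.
Proof. by move=> FA FB; apply: (@filter_ex _ F); exact: filterI. Qed.

Lemma ultrafilter_setVsetC (T : Type) (F : set_system T) (FF : ProperFilter F) :
  (forall A, F A \/ F (~` A)) -> UltraFilter F.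
Proof.
move=> FVC; split=> // G GF FG; rewrite eqEsubset; split=> // A GA.
have [//|/FG GnA] := FVC A.
by have [x []] := filterI_ex GA GnA.
Qed.

Lemma ultrafilter_fmap {T U : Type} (f : T -> U) {F : set_system T}
  {FU : UltraFilter F} : UltraFilter (fmap f F).
Proof.
by apply: ultrafilter_setVsetC => A; exact: (in_ultra_setVsetC (f @^-1` A) FU).
Qed.

Lemma stone_base_open (T : Type) (A : set T) : open (stone_base A).
Proof. by exists [set A]; [|rewrite bigcup_set1]. Qed.

Lemma nbhs_stone_base (T : Type) (p : stone_cech T) (U : set (stone_cech T)) :
  nbhs p U -> exists2 A : set T, p A & stone_base A `<=` U.
Proof.
rewrite nbhsE => -[V [[D _ <-] [A DA pA]] VU].
by exists A => // q qA; apply: VU; exists A.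
Qed.

#[local] Instance ultrafilter_corona {R : realType} {X : metricType R}
  (p : corona X) : UltraFilter (val p : set_system X).
Proof. exact: ultra_setsP. Qed.

Section corona.
Set Implicit Arguments.
Unset Strict Implicit.
Context {R : realType} {X : metricType R}.
Implicit Types (p q : corona X) (P Q : set X) (S : set (corona X)) (r : R).

Lemma corona_unbounded p P : val p P -> ~ mbounded P.
Proof. by have /set_mem[_] := valP p; exact. Qed.

Lemma corona_of_ultrafilter (F : set_system X) : UltraFilter F ->
  (forall P, F P -> ~ mbounded P) -> exists q, val q = F :> set_system X.
Proof.
move=> FU Fub.
have Fsharp : sharp [set: X] (StoneCech FU) by split; [exact: filterT|].
by exists (Sub (StoneCech FU) (mem_set Fsharp)).
Qed.

Lemma closure_coronaP S p :
  closure S p <-> forall P, val p P -> exists2 q, S q & val q P.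
Proof.
split=> [Sp P pP|Sp U].
  have /Sp[q [Sq qP]] : nbhs p (val @^-1` stone_base P).
    apply: (@initial_continuous _ _ (val : corona X -> stone_cech X) p).
    by apply: open_nbhs_nbhs; split; [exact: stone_base_open|].
  by exists q.
rewrite nbhsE => -[V [[W oW <-] Wp] VU].
have /nbhs_stone_base[P pP PW] : nbhs (val p) W by exact: open_nbhs_nbhs.
by have [q Sq qP] := Sp _ pP; exists q; split=> //; apply: VU; exact: PW.
Qed.

Lemma mbounded_mball_set P r : 0 <= r -> mbounded P -> mbounded (mball_set P r).
Proof.
move=> r0 [x [s [s0 Ps]]]; exists x, (s + r); split; first exact: addr_ge0.
move=> y [z Pz zy]; apply: (le_trans (metric_triangle x z y)).
by apply: lerD => //; exact: Ps.
Qed.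

Lemma mball_setS P r r' : r <= r' -> mball_set P r `<=` mball_set P r'.
Proof. by move=> rr' y [z Pz zy]; exists z => //; exact: le_trans zy rr'. Qed.

Lemma parallel_refl p : parallel p p.
Proof.
exists 0; split=> // Q; apply: filterS => x Qx.
by exists x => //; rewrite /mball/= mdistxx.
Qed.

(** If [q] misses [mball_set P r], it contains the complement, whose [r]-ball lies in [p] yet is
    disjoint from [P]. *)
Lemma parallel_sym p q : parallel p q -> parallel q p.
Proof.
move=> [r [r0 pq]]; exists r; split=> // P pP.
have [//|/pq pQ] := in_ultra_setVsetC (mball_set P r) (ultrafilter_corona q).
have [x [Px [y yP yx]]] := filterI_ex pP pQ.
by exfalso; apply: yP; exists x => //; rewrite /mball/= metric_sym.
Qed.

(* Moving each point of [mball_set Q r] to a point of [Q] within distance [r]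
   pushes [p] forward to the required ultrafilter. *)
Lemma parallel_member p Q r : 0 <= r -> val p (mball_set Q r) ->
  exists2 q, parallel p q & val q Q.
Proof.
move=> r0 pQr.
have /choice[f fE] (x : X) : exists y,
    mball_set Q r x -> Q y /\ mdist y x <= r.
  have [[y Qy yx]|nQx] := pselect (mball_set Q r x); first by exists y.
  (* Arbitrary default: [p] ignores points outside [mball_set Q r]. *)
  by exists x.
(* This yields both that the pushforward has only unbounded members and that it is parallel to
   [p]. *)
have near_f A : val p (f @^-1` A) -> val p (mball_set A r).
  move=> pA; apply: filterS (filterI pA pQr) => x [Afx /fE[_ fx]].
  by exists (f x).
have [|q qE] := corona_of_ultrafilter (F := fmap f (val p)) (ultrafilter_fmap _).
  by move=> A /near_f/corona_unbounded + /(mbounded_mball_set r0).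
exists q; last by rewrite qE; apply: filterS pQr => x /fE[].
by exists r; split=> // A; rewrite qE; exact: near_f.
Qed.

Lemma closure_invariant S : invariant_set S -> invariant_set (closure S).
Proof.
move=> Sinv p /closure_coronaP Sp q [r [r0 pq]].
apply/closure_coronaP => Q /pq/Sp[s Ss sQ].
by have [s' /(Sinv _ Ss)] := parallel_member r0 sQ; exists s'.
Qed.

Lemma parallel_trans p q s : parallel p q -> parallel q s -> parallel p s.
Proof.
move=> [r [r0 pq]] [r' [r'0 qs]]; exists (r' + r); split; first exact: addr_ge0.
move=> Q /qs/pq; apply: filterS => x [y [z Qz zy] yx]; exists z => //.
by apply: (le_trans (metric_triangle z y x)); exact: lerD.
Qed.

Lemma parallel_class_invariant p : invariant_set (parallel_class p).
Proof. by move=> q pq s; exact: parallel_trans. Qed.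

(** Compactness for sequences: [q] is an ultrafilter extending the filter of sets that eventually
    belong to [u n]. *)
Lemma corona_cluster (u : nat -> corona X) : exists2 q,
  closure (range u) q &
  forall P, (\forall n \near \oo, val (u n) P) -> val q P.
Proof.
pose F : set_system X := [set P | \forall n \near \oo, val (u n) P].
have FF : ProperFilter F.
  apply: Build_ProperFilter_ex => [P [N _ /(_ N (leqnn _))/filter_ex//]|].
  split=> [|P Q FP FQ|P Q PQ]; rewrite /F/=.
  - by apply: nearW => n; exact: filterT.
  - by near=> n; apply: filterI; near: n.
  - by apply: filterS => n; exact: filterS.
have [G [GU FG]] := ultraFilterLemma FF.
(* Otherwise the complement of [P] lies in every [u n], hence in [F] and in [G]. Both the
   unboundedness of members of [G] and the closure claim follow. *)
have Gu P : G P -> exists n, val (u n) P.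
  move=> GP; apply: contrapT => /forallNP nuP.
  have /FG GnP : F (~` P).
    apply: nearW => n.
    by have [/nuP|] := in_ultra_setVsetC P (ultrafilter_corona (u n)).
  by have [x []] := filterI_ex GP GnP.
have [|q qE] := corona_of_ultrafilter GU.
  by move=> P /Gu[n]; exact: corona_unbounded.
exists q; last by move=> P uP; rewrite qE; exact: FG.
apply/closure_coronaP => P; rewrite qE => /Gu[n unP].
by exists (u n) => //; exists n.
Unshelve. all: by end_near. Qed.

(** The closure of the class is itself closed and invariant, and lies in [S]. *)
Lemma minimal_closed_invariantP S p : minimal_closed_invariant S -> S p ->
  closure (parallel_class p) = S.
Proof.
move=> [[_ cS Sinv] Smin] Sp; apply: Smin.
  split; first by exists p; apply: subset_closure; exact: parallel_refl.
  - exact: closed_closure.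
  - by apply: closure_invariant; exact: parallel_class_invariant.
by rewrite [X in _ `<=` X](closure_id S).1//; apply: closureS; exact: Sinv.
Qed.

End corona.

Theorem theorem3p1 (R : realType) (X : metricType R)
  (unboundedX : ~ mbounded [set: X]) (p : corona X) :
  minimal_closed_invariant (closure (parallel_class p)) <->
  (forall P : set X, val p P ->
    exists r : R, 0 <= r /\
      val @` parallel_class p `<=` sharp (mball_set P r)).
Proof.
split=> [Kmin P pP|bounded_gap].
- apply: contrapT => /forallNP nr.
  have /choice[u uE] (n : nat) : exists q,
      parallel_class p q /\ ~ val q (mball_set P n%:R).
    apply: contrapT => /forallNP nq; apply: (nr n%:R); split=> // _ [q pq <-].
    split; last exact: corona_unbounded.
    by apply: contrapT => qP; exact: (nq q).
  have [q uq qu] := corona_cluster u.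
  have Kq : closure (parallel_class p) q.
    by apply: closureS uq => _ [n _ <-]; exact: (uE n).1.
  (* By minimality the class of [q] is dense in the closure of the class of [p]. *)
  have : closure (parallel_class q) p.
    rewrite (minimal_closed_invariantP Kmin Kq).
    by apply: subset_closure; exact: parallel_refl.
  move=> /closure_coronaP/(_ P pP)[s [r [r0 qs]] /qs qP].
  (* For [n] at least [r], [u n] avoids [mball_set P n%:R], hence also the smaller
     [mball_set P r]. *)
  have /qu qnP : \forall n \near \oo, val (u n) (~` mball_set P r).
    near=> n.
    have [|//] := in_ultra_setVsetC (mball_set P r) (ultrafilter_corona (u n)).
    have rn : r <= n%:R by near: n; exact: nbhs_infty_ger.
    by move=> /(filterS (mball_setS rn))/(uE n).2.
  by have [x []] := filterI_ex qP qnP.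
- split.
    split; first by exists p; apply: subset_closure; exact: parallel_refl.
    + exact: closed_closure.
    + by apply: closure_invariant; exact: parallel_class_invariant.
  move=> S [[q Sq] cS Sinv] SK; rewrite eqEsubset; split=> //.
  (* Once [p] is in [S], so is the closure of its class. *)
  have Sp : S p.
    rewrite (closure_id S).1//; apply/closure_coronaP => P pP.
    have [r [r0 Pr]] := bounded_gap P pP.
    (* The uniform [r] passes to the closure: a complement in [q] would belong to some [s] in the
       class. *)
    have qPr : val q (mball_set P r).
      have [//|qnP] := in_ultra_setVsetC (mball_set P r) (ultrafilter_corona q).
      have /closure_coronaP/(_ _ qnP)[s ps snP] := SK _ Sq.
      have [sP _] : sharp (mball_set P r) (val s) by apply: Pr; exists s.
      by have [x []] := filterI_ex sP snP.
    by have [s /(Sinv _ Sq)] := parallel_member r0 qPr; exists s.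
  by rewrite [X in _ `<=` X](closure_id S).1//; apply: closureS; exact: Sinv.
Unshelve. all: by end_near. Qed.
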